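(* Let $n$ be a positive integer, let $K$ be a field whose characteristic does not divide $n$, fix an algebraic closure $\overline{K}$ of $K$, let $\zeta_n\in\overline{K}$ be a primitive $n$-th root of unity and put $M=K(\zeta_n)$. Let $L\subseteq\overline{K}$ be a strongly decomposable extension of $K$, and let $\alpha_1,\dots,\alpha_k\in L$ be such that $L=K(\alpha_1,\dots,\alpha_k)$ and, whenever $i\neq j$, $K(\alpha_i)/K$ and $K(\alpha_j)/K$ are strongly disjoint almost classically Galois extensions. Then the following are equivalent: (1) $L\cap M=K$, $\alpha_i^n\in K$ for every $1\leq i\leq k$, and $n$ is the smallest positive integer $m$ such that $\alpha_i^m\in K$ for all $1\le i\le k$. (2) $L/K$ is an almost Kummer extension of exponent $n$ with Galois complement $M$, and $\alpha_1,\dots,\alpha_k$ are $H$-eigenvectors, where $H$ is the almost classically Galois structure on $L/K$ corresponding to $M$.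
   Context: Hopf-Galois structures: for a finite extension $L/K$, a Hopf-Galois structure is a pair $(H,\cdot)$ with $H$ a finite-dimensional cocommutative $K$-Hopf algebra and $\cdot$ a $K$-linear action of $H$ on $L$ making $L$ an $H$-module algebra ($h\cdot 1=\epsilon_H(h)$, $h\cdot(xy)=\sum_{(h)}(h_{(1)}\cdot x)(h_{(2)}\cdot y)$) such that the map $L\otimes_K H\to \mathrm{End}_K(L)$, $x\otimes h\mapsto (y\mapsto x(h\cdot y))$, is bijective. Greither–Pareigis description: for a finite separable $L/K$ with normal closure $\widetilde L$, let $G=\mathrm{Gal}(\widetilde L/K)$, $G'=\mathrm{Gal}(\widetilde L/L)$, $X=G/G'$ and $\lambda:G\to\mathrm{Perm}(X)$, $\lambda(g)(hG')=ghG'$. Hopf-Galois structures on $L/K$ correspond bijectively to regular subgroups $N\le\mathrm{Perm}(X)$ normalized by $\lambda(G)$; the structure given by $N$ is $H=\widetilde L[N]^G$ ($G$ acting on $\widetilde L$ naturally and on $N$ by conjugation by $\lambda(g)$), acting by $(\sum_\eta h_\eta\eta)\cdot\alpha=\sum_\eta h_\eta\, g_\eta(\alpha)$, where $\eta^{-1}(1_GG')=g_\eta G'$. Almost classically Galois: $L/K$ finite separable is almost classically Galois if $G'$ has a normal complement $J$ in $G$; then $M=\widetilde L^J$ is called a Galois complement (equivalently: $M/K$ Galois, $L$ and $M$ are $K$-linearly disjoint and $LM=\widetilde L$). The almost classically Galois structure corresponding to $M$ is the Hopf-Galois structure given by the regular subgroup $N$ = centralizer of $\lambda(J)$ in $\mathrm{Perm}(X)$.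 $L/K$ is almost Kummer of exponent $n$ (with complement $M$) if $J=\mathrm{Gal}(\widetilde L/M)$ is abelian of exponent $n$. Two almost classically Galois extensions $L_1/K,L_2/K$ (inside $\overline K$) with Galois complements $M_1,M_2$ are strongly disjoint if $L_1,L_2$ are $K$-linearly disjoint and $L_1\cap M_2=L_2\cap M_1=K$. An extension is strongly decomposable if it is the compositum of finitely many pairwise strongly disjoint almost classically Galois extensions. If $L/K$ is $H$-Galois, a nonzero $\alpha\in L$ is an $H$-eigenvector if for every $h\in H$ there is $\lambda(h)\in K$ with $h\cdot\alpha=\lambda(h)\alpha$.
   Formalization: The formal theorem assumes every α_i is nonzero; otherwise the equivalence fails (K=ℚ, n=3, α=(∛2,0): (1) holds, but 0 is not an eigenvector, so (2) fails). *)

(* Defs.v *)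
From HB Require Import structures.
From mathcomp Require Import all_boot all_order all_fingroup all_algebra.
From mathcomp Require Import all_solvable all_field.

Set Implicit Arguments.
Unset Strict Implicit.
Unset Printing Implicit Defensive.

Import GroupScope GRing.Theory AEnd_FinGroup.
Local Open Scope ring_scope.

(* The algebraic closure of K only serves as an ambient field for finite       *)
(* extensions of K.  As everywhere in MathComp's Galois theory, the ambient    *)
(* field is an arbitrary finite normal, not necessarily separable, extension   *)
(* Omega of K ([splittingFieldType K]); any finite subset of an algebraic      *)
(* closure lies in such an Omega.  Subextensions of Omega / K are subfields    *)
(* of Omega, and K itself is 1%VS.                                             *)
(*                                                                             *)
(* In [gal_of E] the product x * y is "x, then y", the opposite of composition *)
(* (see [galM]); permutations multiply in the same way.  Hence, a left coset   *)
(* gG' with respect to composition is the right coset G' :* g below, and left  *)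
(* translation by g is right multiplication by g.                              *)

Section CosetPermutations.

Variables (gT : finGroupType) (G G' : {group gT}).

(* X = G / G' *)
Definition cosetX := {C : {set gT} | C \in rcosets G' G}.

Fact base_cosetX_subproof : gval G' \in rcosets G' G.
Proof. by apply/rcosetsP; exists 1%g; rewrite ?group1 ?mulg1. Qed.

Definition base_cosetX : cosetX := exist _ (gval G') base_cosetX_subproof.

(* lambda : G -> Perm(X); ['Rs^?] is right multiplication restricted to X.     *)
Definition lambdaX (g : gT) : {perm cosetX} := actperm ('Rs^?)%act g.

Lemma lambdaXE (g : gT) (C : cosetX) :
  G' \subset G -> g \in G -> val (lambdaX g C) = val C :* g.
Proof.
move=> sG'G Gg; rewrite actpermE val_subact ifT //= ?rcosetE //.
rewrite !inE /=; apply/subsetP=> A; rewrite !inE /= rcosetE => /rcosetsP[x Gx ->].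
by rewrite -rcosetM mem_rcosets mulSGid // groupM.
Qed.

End CosetPermutations.

Section HopfGalois.

Variables (K : fieldType) (Omega : splittingFieldType K).
Implicit Types (L M E : {subfield Omega}).

(* The normal closure of L / K: the compositum of the K-conjugates of L.       *)
(* Elements of 'AEnd(Omega) are the K-automorphisms of Omega.                  *)
Definition normal_closure L : {subfield Omega} :=
  (agenv (\sum_(f : 'AEnd(Omega)) f @: L))%AS.

Lemma sub_normal_closure L : (L <= normal_closure L)%VS.
Proof.
apply: subv_trans (sub_agenv _).
by apply: (sumv_sup (1%g : 'AEnd(Omega))); rewrite // lim1g.
Qed.

Lemma normal_closure_normal L : normalField 1 (normal_closure L).
Proof.
apply/forall_inP=> f _.
rewrite eqEdim limg_dim_eq ?leqnn ?andbT; last first.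
  by rewrite (eqP (AEnd_lker0 f)) capv0.
rewrite aimg_agen; apply: agenvS; rewrite limg_sum.
apply/subv_sumP=> g _; rewrite -limg_comp.
exact: (sumv_sup (f \o g)%AF).
Qed.

Lemma normal_closure_min L E :
  (L <= E)%VS -> normalField 1 E -> (normal_closure L <= E)%VS.
Proof.
move=> sLE /forall_inP nE; rewrite -[E : {vspace _}]subfield_closed; apply: agenvS.
apply/subv_sumP=> f _; apply: subv_trans (limgS f sLE) _.
by rewrite (eqP (nE f _)) // inE kAutfE k1AHom.
Qed.

(* G = Gal(L~ / K), G' = Gal(L~ / L), X = G / G'. *)
Definition galG L : {group gal_of (normal_closure L)} :=
  'Gal(normal_closure L / 1)%G.
Definition galG' L : {group gal_of (normal_closure L)} :=
  'Gal(normal_closure L / L)%G.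
Definition galX L := cosetX (galG L) (galG' L).
Definition galJ L M : {group gal_of (normal_closure L)} :=
  'Gal(normal_closure L / M)%G.

(* L / K is almost classically Galois with Galois complement M. *)
Definition galois_complement L M : Prop :=
  separable 1 L /\
  exists J : {group gal_of (normal_closure L)},
    [/\ J <| galG L, J \in [complements to galG' L in galG L]
      & M = fixedField J :> {vspace Omega}].

Definition almost_classically_galois L : Prop :=
  exists M, galois_complement L M.

(* For M = L~^J as above, J = galJ L M. *)
Definition almost_kummer (n : nat) L M : Prop :=
  [/\ galois_complement L M, abelian (galJ L M) & exponent (galJ L M) = n].

(* K-linear disjointness: families in L1 that are linearly independent over K *)
(* remain so over L2, i.e., L1 (x)_K L2 -> Omega is injective.                *)
Definition linearly_disjoint (L1 L2 : {subfield Omega}) : Prop :=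
  forall (m : nat) (a : m.-tuple Omega) (c : 'I_m -> Omega),
    {subset a <= L1} -> free a -> (forall i, c i \in L2) ->
    \sum_i c i * tnth a i = 0 -> forall i, c i = 0.

(* Relative to some choice of Galois complements M1 and M2.                    *)
Definition strongly_disjoint (L1 L2 : {subfield Omega}) : Prop :=
  exists M1 M2 : {subfield Omega},
    [/\ galois_complement L1 M1, galois_complement L2 M2,
        linearly_disjoint L1 L2,
        (L1 :&: M2)%VS = 1%VS & (L2 :&: M1)%VS = 1%VS].

Definition strongly_decomposable L : Prop :=
  exists (r : nat) (Ls : 'I_r -> {subfield Omega}),
    [/\ forall i, almost_classically_galois (Ls i),
        forall i j, i != j -> strongly_disjoint (Ls i) (Ls j)
      & L = agenv (\sum_i Ls i) :> {vspace Omega}].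

(* Greither-Pareigis: the K-space L~[N]^G underlying the Hopf algebra of a     *)
(* subgroup N of Perm(X) normalized by lambda(G).  An element sum_eta h_eta    *)
(* eta of L~[N] is its coefficient function; in {perm X}, eta ^ s is           *)
(* s o eta o s^-1.                                                             *)
Definition gp_algebra L (N : {set {perm galX L}})
    (h : {ffun {perm galX L} -> Omega}) : Prop :=
  [/\ forall eta, eta \notin N -> h eta = 0,
      forall eta, h eta \in normal_closure L
    & forall g eta, g \in galG L -> eta \in N ->
        h (eta ^ lambdaX (galG L) (galG' L) g)%g = g (h eta)].

(* [repr] picks a representative g_eta of the coset eta^-1(1_G G'); on L the   *)
(* choice is irrelevant, see [gp_actE].                                        *)
Definition gp_act L (N : {set {perm galX L}})
    (h : {ffun {perm galX L} -> Omega}) (a : Omega) : Omega :=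
  \sum_(eta in N)
    h eta * repr (val ((eta^-1)%g (base_cosetX (galG L) (galG' L)))) a.

Lemma gp_actE L (N : {set {perm galX L}}) h a
    (g : {perm galX L} -> gal_of (normal_closure L)) :
    a \in L ->
    (forall eta, eta \in N ->
       g eta \in val ((eta^-1)%g (base_cosetX (galG L) (galG' L)))) ->
  gp_act N h a = \sum_(eta in N) h eta * g eta a.
Proof.
move=> La gP; apply: eq_bigr => eta Neta; congr (_ * _).
have := gP eta Neta; case: (_ (base_cosetX _ _)) => C /= /rcosetsP[x _ ->] gC.
have sLE := sub_normal_closure L.
have actE y : y \in galG' L :* x -> y a = x a.
  case/rcosetP=> s Ls ->; have Ea := subvP sLE a La.
  by rewrite galM // (fixed_gal sLE Ls La).
by rewrite !actE // (mem_repr (g eta)).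
Qed.

(* The regular subgroup giving the almost classically Galois structure on      *)
(* L / K corresponding to the Galois complement M.                             *)
Definition acg_group L M : {group {perm galX L}} :=
  'C([set lambdaX (galG L) (galG' L) g | g in galJ L M])%G.

Definition hopf_eigenvector L (N : {set {perm galX L}}) (a : Omega) : Prop :=
  [/\ a \in L, a != 0
    & forall h, gp_algebra N h -> exists c : K, gp_act N h a = c *: a].

End HopfGalois.

(* Main.v *)
Require Import Defs.
From HB Require Import structures.
From mathcomp Require Import all_boot all_order all_fingroup all_algebra.
From mathcomp Require Import all_solvable all_field.

Set Implicit Arguments.
Unset Strict Implicit.
Unset Printing Implicit Defensive.

Import GroupScope GRing.Theory AEnd_FinGroup.
Local Open Scope ring_scope.

(* Put E = L~, J = Gal(E / M).  When J is an abelian normal complement of G'   *)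
(* in G, it acts regularly on X, so N = lambda(J), and h acts on L as          *)
(* sum_(t in J) h(lambda t) t^-1.  By Dedekind's independence of characters, a *)
(* is then an eigenvector iff all the quotients t(a) / a, t in J, are fixed by *)
(* J, i.e., t |-> t(a) / a is a homomorphism J -> M^*.  Hence t^m fixes a iff  *)
(* t fixes a^m, which matches the exponent of J with the exponents m for which *)
(* all a^m lie in L :&: M = K.  In the direction from radicals to Kummer       *)
(* theory, the point is that zeta lies in E: if zeta^j is in E exactly for     *)
(* d | j, then all conjugates zeta^j alpha_i over M have d | j, so that        *)
(* alpha_i^(n / d) lies in L :&: M = K, and d = 1 by minimality of n.          *)

(** The Hopf condition is turned into plain Galois theory of [J]. By [hopf_eigenvectorP], the
    eigenvectors are the nonzero [a] in [L] whose quotients [t a / a] are all [J]-invariant, and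
    [galX_fix] then trades powers of [t] for powers of [a]. Since [G' * J = G], an element of [L]
    fixed by [J] lies in [K] ([mem1_fixed_compl]). Since [G' :&: J = 1] and the [alpha_i] generate
    [L], an element of [J] fixing every [alpha_i] is trivial. Hence all [alpha_i ^+ m] lie in [K]
    iff [t ^+ m = 1] on [J], and the two notions of minimal exponent agree. From (1), once [zeta] is
    in the normal closure [E], the generators [zeta, alpha_i] of [E] give that [J] is abelian and
    meets [G'] trivially, while [L :&: M = K] says that [J] and [G'] generate [G]. *)

Section CosetAction.

Variables (gT : finGroupType) (G G' J : {group gT}).
Hypothesis sG'G : G' \subset G.
Let lam := lambdaX G G'.

Lemma lambdaXM : {in G &, {morph lam : x y / (x * y)%g}}.
Proof.
move=> x y Gx Gy; apply/permP=> C; apply: val_inj.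
by rewrite permM !lambdaXE ?groupM // rcosetM.
Qed.

Lemma lambdaXV : {in G, {morph lam : x / x^-1%g}}.
Proof.
move=> x Gx; apply: (mulgI (lam x)); rewrite mulgV -lambdaXM ?groupV // mulgV.
apply/permP=> C; apply: val_inj.
by rewrite lambdaXE ?group1 // rcoset1 perm1.
Qed.

Lemma lambdaXJ : {in G &, {morph lam : x y / (x ^ y)%g}}.
Proof.
move=> x y Gx Gy.
by rewrite /conjg !lambdaXM ?groupM ?groupV // lambdaXV.
Qed.

Hypotheses (complJ : J \in [complements to G' in G]) (abJ : abelian J).

Let sJG : J \subset G.
Proof. by case/complP: complJ => _ <-; rewrite mulG_subr. Qed.

(** The image of the base coset already determines [x] in [J]: if [G' x = G' y], then [x y^-1] lies
    in [G' :&: J = 1]. *)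
Lemma lambdaX_inj : {in J &, injective lam}.
Proof.
move=> x y Jx Jy /(congr1 (fun s : {perm _} => val (s (base_cosetX G G')))).
rewrite !lambdaXE ?(subsetP sJG) //= => /rcoset_eqP; rewrite mem_rcoset => G'xy.
have: (x * y^-1)%g \in G' :&: J by rewrite inE G'xy groupM ?groupV.
case/complP: complJ => -> _; rewrite inE -eq_mulgV1; exact/eqP.
Qed.

(* A transitive abelian permutation group is its own centralizer. *)
Lemma cent_lambdaX : 'C([set lam g | g in J]) = [set lam g | g in J].
Proof.
apply/setP=> eta; apply/centP/imsetP=> [cJ | [x Jx ->] _ /imsetP[y Jy ->]].
  have transJ (C : cosetX G G') : exists2 x, x \in J & C = lam x (base_cosetX G G').
    have /rcosetsP[g Gg defC] := valP C.
    have [_ defG] := complP complJ.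
    have /mulsgP[y x G'y Jx defg]: g \in (G' * J)%g by rewrite defG.
    exists x => //; apply: val_inj; rewrite lambdaXE ?(subsetP sJG) //=.
    by rewrite defC defg rcosetM rcoset_id.
  have [x Jx eta_x] := transJ (eta (base_cosetX G G')).
  exists x => //; apply/permP=> C; have [y Jy ->] := transJ C.
  have {}cJ: commute eta (lam y) by apply: cJ; apply: imset_f.
  rewrite -permM -cJ permM eta_x -!permM -!lambdaXM ?(subsetP sJG) //.
  by rewrite (centsP abJ x Jx).
rewrite /commute -!lambdaXM ?(subsetP sJG) //.
by rewrite (centsP abJ x Jx).
Qed.

End CosetAction.

(** * Normality, separability and conjugates of radicals *)

Section Fields.

Variables (K : fieldType) (Omega : splittingFieldType K).
Implicit Types (L M E : {subfield Omega}).

Lemma AEnd_fix1 (f : 'AEnd(Omega)) a : a \in 1%VS -> f a = a.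
Proof. by have /kAHomP := k1AHom 1 f; apply. Qed.

Lemma normalField1P E :
  reflect (forall f : 'AEnd(Omega), (f @: E <= E)%VS) (normalField 1 E).
Proof.
apply: (iffP forall_inP) => [nE f | nE f _].
  by rewrite (eqP (nE f _)) ?subvv // inE kAutfE k1AHom.
by rewrite eqEdim nE limg_dim_eq ?leqnn // (eqP (AEnd_lker0 f)) capv0.
Qed.

Lemma normalField_adjoin_seq (rs : seq Omega) :
    (forall f : 'AEnd(Omega), {in rs, forall a, f a \in <<1 & rs>>%VS}) ->
  normalField 1 <<1 & rs>>.
Proof.
move=> fP; apply/(normalField1P <<1 & rs>>%AS)=> f.
rewrite aimg_adjoin_seq aimg1; apply/Fadjoin_seqP; split; first exact: sub1v.
by move=> _ /mapP[a rs_a ->]; apply: fP.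
Qed.

(** The closure is generated by the conjugates of a basis of [L], and a conjugate of [x] is a root
    of the separable polynomial [minPoly 1 x]. *)
Lemma separable_normal_closure L : separable 1 L -> separable 1 (normal_closure L).
Proof.
move=> sepL.
pose rs := [seq (f : 'AEnd(Omega)) x | f <- enum {: 'AEnd(Omega)}, x <- vbasis L].
have: separable 1 <<1 & rs>>%VS.
  apply/separable_Fadjoin_seq/allP=> _ /allpairsP[[f x] [_ /= /vbasis_mem Lx ->]].
  apply/separable_elementP.
  exists (minPoly 1 x); split; first exact: minPolyOver.
    apply: (@kHom_root_id _ _ 1%AS {:Omega}%AS); rewrite ?sub1v ?memvf //.
    - exact: k1AHom.
    - exact: minPolyOver.
    - exact: root_minPoly.
  exact: (separableP sepL).
apply: separableSr; rewrite -[X in (_ <= X)%VS]subfield_closed.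
apply: agenvS; apply/subv_sumP=> f _; apply/subvP=> _ /memv_imgP[x Lx ->].
rewrite (coord_vbasis Lx) linear_sum; apply: rpred_sum => i _.
rewrite linearZ; apply/rpredZ/seqv_sub_adjoin/allpairsP.
by exists (f, (vbasis L)`_i); rewrite mem_enum memt_nth.
Qed.

Lemma galois_normal_closure L : separable 1 L -> galois 1 (normal_closure L).
Proof.
by move=> sepL; rewrite /galois sub1v separable_normal_closure ?normal_closure_normal.
Qed.

Lemma separable_radical n (a : Omega) :
    n%:R != 0 :> Omega -> a != 0 -> a ^+ n \in 1%VS ->
  separable_element 1 a.
Proof.
move=> nz_n nz_a Kan; apply/separable_elementP.
have n_gt0: (0 < n)%N by apply: contraNltn nz_n; rewrite leqn0 => /eqP->.
exists ('X^n - (a ^+ n)%:P); split.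
- by rewrite rpredB ?polyOverXn ?polyOverC.
- by rewrite rootE !hornerE subrr.
rewrite unlock derivB derivXn derivC subr0; apply/Bezout_eq1_coprimepP.
(* Bezout coefficients for ['X^n - a^n] and its derivative [n X^(n-1)]: multiplying the latter by
   [X / (n a^n)] gives [X^n / a^n]. *)
exists (- (a ^+ n)^-1%:P, (n%:R * a ^+ n)^-1 *: 'X) => /=.
rewrite -(scaler_nat n 'X^_) -scalerAl -scalerAr -exprS prednK // scalerA invfM mulrAC.
rewrite mulVf // mul1r -mul_polyC mulrBr !mulNr opprK addrAC addNr add0r.
by rewrite -polyCM mulVf // expf_neq0.
Qed.

Variable n : nat.
Variable zeta : Omega.
Hypothesis zeta_prim : n.-primitive_root zeta.

Lemma radical_conj (f : 'AEnd(Omega)) (a : Omega) : a != 0 -> a ^+ n \in 1%VS ->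
  exists i : 'I_n, f a = zeta ^+ i * a.
Proof.
move=> nz_a Kan; have /(prim_rootP zeta_prim)[i Di]: (f a / a) ^+ n = 1.
  by rewrite expr_div_n -rmorphXn /= AEnd_fix1 // divff // expf_neq0.
by exists i; rewrite -Di divfK.
Qed.

End Fields.

(** * Eigenvectors of the almost classically Galois structure *)

Section Eigenvectors.

Variables (K : fieldType) (Omega : splittingFieldType K).
Variables (L M : {subfield Omega}).

Local Notation E := (normal_closure L).
Local Notation G := (galG L).
Local Notation G' := (galG' L).
Local Notation J := (galJ L M).
Local Notation lam := (lambdaX G G').

Let sG'G : G' \subset G.
Proof. exact/galS/sub1v. Qed.

(** By the Galois correspondence, the complement in the definition is forced to be the group fixing
    its own fixed field [M]. *)
Lemma galois_complementE : galois_complement L M ->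
  [/\ separable 1 L, J <| G, J \in [complements to G' in G]
    & M = fixedField J :> {vspace Omega}].
Proof.
case=> sepL [H [nsHG complH defM]].
suffices ->: J = H by [].
by apply: val_inj; rewrite /= defM gal_fixedField.
Qed.

Hypotheses (sepL : separable 1 L) (nsJG : J <| G).
Hypotheses (complJ : J \in [complements to G' in G]) (abJ : abelian J).

Let sJG : J \subset G := normal_sub nsJG.

Let sLE : {subset L <= E}.
Proof. exact/subvP/sub_normal_closure. Qed.

Lemma mem1_fixed_compl a :
    a \in E -> {in G', forall g : gal_of E, g a = a} ->
    {in J, forall g : gal_of E, g a = a} ->
  a \in 1%VS.
Proof.
move=> Ea fixG' fixJ.
have /galois_fixedField <- := galois_normal_closure sepL.
apply/fixedFieldP=> // g Gg; have [_ defG] := complP complJ.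
have /mulsgP[x y G'x Jy ->]: g \in (G' * J)%g by rewrite defG.
by rewrite galM // fixG' // fixJ.
Qed.

Lemma mem_acg_group eta : (eta \in acg_group L M) = (eta \in [set lam t | t in J]).
Proof. by rewrite -(cent_lambdaX sG'G complJ abJ). Qed.

Lemma gp_act_abelian (h : {ffun {perm galX L} -> Omega}) a : a \in L ->
  gp_act (acg_group L M) h a = \sum_(t in J) h (lam t) * (t^-1)%g a.
Proof.
(* The inverse of [lam t] sends the base coset to [G' t^-1], so [t^-1] is a valid representative;
   the default is never reached on the acting group. *)
move=> La; pose g eta := ((odflt 1%g [pick t in J | lam t == eta])^-1)%g.
have gE : {in J, forall t, g (lam t) = (t^-1)%g}.
  move=> t Jt; rewrite /g; case: pickP => [u /andP[Ju /eqP]|/(_ t)]; last first.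
    by rewrite Jt eqxx.
  by move=> eq_ut; rewrite /= (lambdaX_inj sG'G complJ Ju Jt eq_ut).
rewrite (gp_actE _ (g := g)) // => [|eta].
  rewrite (eq_bigl _ _ mem_acg_group) big_imset /=; last exact: lambdaX_inj complJ.
  by apply: eq_bigr => t Jt; rewrite gE.
rewrite mem_acg_group => /imsetP[t Jt ->]; have Gt := subsetP sJG t Jt.
by rewrite gE // -lambdaXV // lambdaXE ?groupV //= rcoset_refl.
Qed.

(** If the quotients are [J]-invariant, the candidate eigenvalue [c] is fixed by both [G'] and [J],
    so it lies in [K]. Conversely, every eigenvalue lies in [K], and there are enough elements [h]
    to isolate each quotient. *)
Lemma hopf_eigenvectorP a :
  hopf_eigenvector (acg_group L M) a <->
  [/\ a \in L, a != 0
    & {in J &, forall s t : gal_of E, s (t a / a) = t a / a}].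
Proof.
split=> [[La nz_a eig_a] | [La nz_a fix_a]]; split=> //; last first.
  move=> h [h0 hE hG]; pose c := \sum_(t in J) h (lam t) * ((t^-1)%g a / a).
  have Ea := sLE La.
  (* The [G]-equivariance of [h] lets [g] permute the terms of [c] by [t |-> t ^ g], provided that
     the quotients follow. For [g] in [G'] they do because [g] fixes [a]; for [g] in [J], because
     [t ^ g = t]. *)
  have fixc : {in G, forall g : gal_of E,
     (forall t : gal_of E, t \in J -> g (t a / a) = (t ^ g)%g a / a) -> g c = c}.
    move=> g Gg ga; rewrite /c rmorph_sum /= [RHS](reindex_inj (conjg_inj g)) /=.
    apply: eq_big => [t|t Jt]; first by rewrite memJ_norm // (subsetP (normal_norm nsJG)).
    rewrite rmorphM /= ga ?groupV // conjVg lambdaXJ ?(subsetP sJG t Jt) //.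
    by congr (_ * _); apply/esym/hG; rewrite // mem_acg_group imset_f.
  have /vlineP[k Dc]: c \in 1%VS.
    apply: mem1_fixed_compl => [|g G'g|g Jg].
    - apply: rpred_sum => t _; apply: rpredM; first exact: hE.
      by rewrite rpredM ?rpredV ?memv_gal.
    - apply: fixc => [|t Jt]; first exact: (subsetP sG'G).
      have ga : g a = a := fixed_gal (sub_normal_closure L) G'g La.
      have gVa : (g^-1)%g a = a := fixed_gal (sub_normal_closure L) (groupVr G'g) La.
      by rewrite /conjg !galM ?memv_gal // gVa rmorphM fmorphV /= ga.
    apply: fixc => [|t Jt]; first exact: (subsetP sJG).
    by rewrite fix_a // /conjg (centsP abJ t Jt g Jg) mulKg.
  exists k; rewrite gp_act_abelian // -[k *: a]mulr_algl -Dc mulr_suml.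
  by apply: eq_bigr => t _; rewrite -mulrA divfK.
have Ea := sLE La.
suffices fixV s t : s \in J -> t \in J -> s ((t^-1)%g a / a) = (t^-1)%g a / a.
  by move=> s t Js Jt; rewrite -{1 2}[t]invgK fixV ?groupV // invgK.
move=> Js Jt; pose chi (u : gal_of E) : Omega := (u^-1)%g a / a.
have JG g : g \in G -> (t ^ g)%g \in J.
  by move=> Gg; rewrite memJ_norm // (subsetP (normal_norm nsJG)).
(* The orbit sums [sum_g g(b) lambda(t^g)] lie in the Hopf algebra; Dedekind's *)
(* independence of characters extracts the individual terms.                   *)
have fix_orbit b : b \in E -> s (\sum_(g in G) g b * chi (t ^ g)%g) =
    \sum_(g in G) g b * chi (t ^ g)%g.
  move=> Eb; pose h := [ffun eta => \sum_(g in G | lam (t ^ g)%g == eta) g b].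
  have [|c Dc] := eig_a h.
    split=> [eta|eta|g eta Gg _].
    - rewrite mem_acg_group ffunE => N'eta; apply: big1 => g /andP[Gg /eqP Deta].
      by case/negP: N'eta; rewrite -Deta imset_f // JG.
    - by rewrite ffunE; apply: rpred_sum => g _; apply: memv_gal.
    rewrite !ffunE rmorph_sum /= (reindex_inj (mulIg g)) /=.
    apply: eq_big => [x|x _]; last by rewrite galM.
    rewrite groupMr //; apply: andb_id2l => Gx.
    rewrite conjgM lambdaXJ ?(inj_eq (conjg_inj _)) //.
    exact: (subsetP sJG _ (JG x Gx)).
  suffices ->: \sum_(g in G) g b * chi (t ^ g)%g = c%:A.
    by apply: AEnd_fix1; apply/rpredZ/mem1v.
  apply: (mulIf nz_a); rewrite mulr_algl -Dc gp_act_abelian // mulr_suml.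
  rewrite (partition_big (fun g : gal_of E => t ^ g)%g (mem J)) => [|g /JG//].
  apply: eq_bigr => u Ju; rewrite ffunE mulr_suml; apply: eq_big => g.
    apply: andb_id2l => Gg; apply/eqP/eqP=> [-> // | eq_lam].
    exact: (lambdaX_inj sG'G complJ (JG g Gg) Ju eq_lam).
  by case/andP=> _ /eqP->; rewrite -mulrA divfK.
(* As [J] is abelian, [t ^ (g * s) = t ^ g]; reindexing [fix_orbit] by [g |-> g * s] yields
   [\sum_g g b * d g = 0] for every [b] in [E]. The term [g = 1] is the one wanted. *)
pose d g := s (chi (t ^ g)%g) - chi (t ^ g)%g.
have d0 : forall g, g \in G -> d g = 0.
  apply: (@gal_independent _ _ _ (mem G) d) => b Eb; apply/eqP.
  under eq_bigr do rewrite mulrC mulrBr.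
  rewrite sumrB subr_eq0 -fix_orbit // rmorph_sum (reindex_inj (mulIg s)) /=.
  apply/eqP/eq_big => [g|g Gg]; first by rewrite groupMr // (subsetP sJG).
  have Gg' : g \in G by rewrite -(groupMr _ (subsetP sJG s Js)).
  rewrite [RHS]rmorphM galM // conjgM; congr (_ * s (chi _)).
  by rewrite {1}/conjg (centsP abJ _ (JG g Gg') s Js) mulKg.
by have/eqP := d0 1%g (group1 G); rewrite subr_eq0 conjg1 => /eqP.
Qed.

End Eigenvectors.

(** * Radical generators versus the exponent of [J] *)

Section Radical.

Variables (K : fieldType) (Omega : splittingFieldType K).
Implicit Types L M E : {subfield Omega}.

Lemma galX_mem E (t : gal_of E) m a :
    a \in E -> a != 0 -> t (t a / a) = t a / a ->
  (t ^+ m)%g a = (t a / a) ^+ m * a.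
Proof.
move=> Ea nz_a fix_t; elim: m => [|m IHm]; first by rewrite gal_id mul1r.
by rewrite expgSr galM // IHm rmorphM rmorphXn /= fix_t exprSr -mulrA divfK.
Qed.

(** Both equations say that [(t a / a) ^+ m = 1]. *)
Lemma galX_fix E (t : gal_of E) m a :
    a \in E -> a != 0 -> t (t a / a) = t a / a ->
  ((t ^+ m)%g a == a) = (t (a ^+ m) == a ^+ m).
Proof.
move=> Ea nz_a fix_t; rewrite galX_mem // rmorphXn /=.
rewrite -[X in _ == X]mul1r -[X in _ = (X == _)](divfK (expf_neq0 m nz_a)).
by rewrite -[X in _ = (_ == X)]mul1r expr_div_n !(inj_eq (mulIf _)) // expf_neq0.
Qed.

Lemma gal_eq_gen E (rs : seq Omega) (s t : gal_of E) :
    (E <= <<1 & rs>>)%VS -> {subset rs <= E} -> {in rs, s =1 t} -> s = t.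
Proof.
move=> sErs srsE eq_st; apply/eqP; rewrite eq_mulgV1; apply/gal_eqP=> x Ex.
rewrite gal_id; apply/fixedSpaceP; apply: subvP Ex; apply: subv_trans sErs _.
apply/(@Fadjoin_seqP _ _ _ _ (fixedSpace_aspace (s * t^-1)%g)).
split=> [|y rs_y]; first exact: sub1v.
have Ey := srsE y rs_y.
by apply/fixedSpaceP; rewrite galM // eq_st // -galM // mulgV gal_id.
Qed.

Variables (n : nat) (zeta : Omega).
Hypothesis zeta_prim : n.-primitive_root zeta.

(** The exponents [j] with [zeta ^+ j] in [E] form an additive group containing [n]; [d] is its
    least positive element. *)
Lemma primitive_root_expr_mem E :
  exists2 d, (d %| n)%N & forall j, (zeta ^+ j \in E) = (d %| j)%N.
Proof.
have n_gt0 := prim_order_gt0 zeta_prim; have zn1 := prim_expr_order zeta_prim.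
have exP: exists d, (0 < d)%N && (zeta ^+ d \in E).
  by exists n; rewrite n_gt0 zn1 rpred1.
case: (ex_minnP exP) => d /andP[d_gt0 Ed] min_d.
have memE j : (zeta ^+ j \in E) = (d %| j)%N.
  apply/idP/idP=> [Ej | /dvdnP[q ->]]; last by rewrite mulnC exprM rpredX.
  have Er: zeta ^+ (j %% d) \in E.
    rewrite -(@fpredMl _ _ (zeta ^+ (j %/ d * d))).
    - by rewrite -exprD -divn_eq.
    - by rewrite mulnC exprM rpredX.
    by rewrite expf_neq0 // (prim_root_eq0 zeta_prim) -lt0n.
  rewrite /dvdn; case: posnP => // r_gt0.
  by have := min_d (j %% d)%N; rewrite r_gt0 Er leqNgt ltn_mod d_gt0 => /(_ isT).
by exists d; rewrite -?memE ?zn1 ?rpred1.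
Qed.

Variables (M L : {subfield Omega}) (k : nat) (alpha : k.-tuple Omega).
Hypothesis defM : M = <<1; zeta>>%VS :> {vspace Omega}.
Hypothesis alphaL : {subset alpha <= L}.
Hypothesis alpha_neq0 : forall i, tnth alpha i != 0.
Hypothesis defL : L = <<1 & alpha>>%VS :> {vspace Omega}.

Local Notation E := (normal_closure L).
Local Notation G := (galG L).
Local Notation G' := (galG' L).
Local Notation J := (galJ L M).

Let sLE : {subset L <= E}.
Proof. exact/subvP/sub_normal_closure. Qed.

Let alphaLi i : tnth alpha i \in L.
Proof. exact/alphaL/mem_tnth. Qed.

Lemma almost_kummer_radical :
    almost_kummer n L M ->
    (forall i, hopf_eigenvector (acg_group L M) (tnth alpha i)) ->
  [/\ (L :&: M)%VS = 1%VS,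
      forall i, tnth alpha i ^+ n \in 1%VS
    & forall m, (0 < m)%N -> (forall i, tnth alpha i ^+ m \in 1%VS) ->
        (n <= m)%N].
Proof.
case=> /galois_complementE[sepL nsJG complJ fixJ] abJ expJ eig.
have fix_a i : {in J &, forall s t : gal_of E,
    s (t (tnth alpha i) / tnth alpha i) = t (tnth alpha i) / tnth alpha i}.
  by have /(hopf_eigenvectorP sepL nsJG complJ abJ)[] := eig i.
have fixL x : x \in L -> {in G', forall g : gal_of E, g x = x}.
  by move=> Lx g G'g; apply: fixed_gal G'g Lx; apply: sub_normal_closure.
split=> [|i|m m_gt0 Kam].
- apply/eqP; rewrite eqEsubv sub1v andbT; apply/subvP=> x /memv_capP[Lx Mx].
  apply: (mem1_fixed_compl sepL complJ); rewrite ?sLE //; first exact: fixL.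
  by move: Mx; rewrite fixJ => /mem_fixedFieldP[].
- apply: (mem1_fixed_compl sepL complJ); rewrite ?rpredX ?sLE //.
    by apply: fixL; apply: rpredX.
  move=> g Jg; apply/eqP; rewrite -galX_fix ?sLE ?fix_a //.
  by rewrite -expJ expg_exponent // gal_id.
(* If all [alpha_i ^+ m] are in [K], then [t ^+ m] fixes every [alpha_i], hence [L]; so it lies in
   [G' :&: J = 1]. *)
rewrite -expJ; apply: dvdn_leq => //; apply/exponentP=> t Jt.
have [tiG'J _] := complP complJ.
suffices: (t ^+ m)%g \in G' :&: J by rewrite tiG'J => /set1P.
apply/setIP; split; last exact: groupX.
rewrite gal_kHom ?sub_normal_closure //; apply/kAHomP=> x Lx.
apply/fixedSpaceP; apply: subvP Lx; rewrite defL.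
apply/(@Fadjoin_seqP _ _ _ _ (fixedSpace_aspace (t ^+ m)%g)).
split=> [|_ /tnthP[i ->]]; first exact: sub1v.
apply/fixedSpaceP/eqP; rewrite galX_fix ?sLE ?fix_a //.
by rewrite AEnd_fix1.
Qed.

Lemma radical_almost_kummer :
    (L :&: M)%VS = 1%VS -> (forall i, tnth alpha i ^+ n \in 1%VS) ->
    (forall m, (0 < m)%N -> (forall i, tnth alpha i ^+ m \in 1%VS) ->
      (n <= m)%N) ->
  almost_kummer n L M /\
  (forall i, hopf_eigenvector (acg_group L M) (tnth alpha i)).
Proof.
move=> LM1 Kan min_n; have n_gt0 := prim_order_gt0 zeta_prim.
have nz_n : n%:R != 0 :> Omega := prim_root_natf_neq0 zeta_prim.
have nz_zeta : zeta != 0 by rewrite (prim_root_eq0 zeta_prim) -lt0n.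
have Kzn : zeta ^+ n \in 1%VS by rewrite (prim_expr_order zeta_prim) mem1v.
have Mzeta : zeta \in M by rewrite defM memv_adjoin.
pose F := <<1 & zeta :: alpha>>%AS.
have Fzeta : zeta \in F by rewrite seqv_sub_adjoin ?mem_head.
have Falpha i : tnth alpha i \in F.
  by rewrite seqv_sub_adjoin // inE mem_tnth orbT.
have sepL : separable 1 L.
  rewrite defL; apply/separable_Fadjoin_seq/allP=> _ /tnthP[i ->].
  exact: (separable_radical nz_n).
have galF : galois 1 F.
  rewrite /galois sub1v separable_Fadjoin_seq /=; last first.
    rewrite (separable_radical nz_n) //=; apply/allP=> _ /tnthP[i ->].
    exact: (separable_radical nz_n).
  apply: normalField_adjoin_seq => f x; rewrite inE => /predU1P[-> | /tnthP[i ->]].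
    have [j ->] := radical_conj zeta_prim f nz_zeta Kzn.
    by rewrite rpredM ?rpredX.
  have [j ->] := radical_conj zeta_prim f (alpha_neq0 i) (Kan i).
  by rewrite rpredM ?rpredX.
have sLF : (L <= F)%VS.
  by rewrite defL; apply/Fadjoin_seqP; split=> [|_ /tnthP[i ->]]; rewrite ?sub1v.
have sMF : (M <= F)%VS by rewrite defM; apply/FadjoinP; rewrite sub1v.
have sEF : (E <= F)%VS by apply: normal_closure_min sLF _; case/and3P: galF.
have Ezeta : zeta \in E.
  have [d d_n memE] := primitive_root_expr_mem E.
  have d_gt0 := dvdn_gt0 n_gt0 d_n.
  rewrite -[zeta]expr1 memE dvdn1 eqn_leq d_gt0 andbT leqNgt; apply/negP=> d_gt1.
  suffices: (n <= n %/ d)%N by rewrite leqNgt ltn_Pdiv.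
  apply: (min_n (n %/ d)%N) => [|i]; first by rewrite divn_gt0 // dvdn_leq.
  rewrite -LM1 memv_cap rpredX //=.
  have /galois_fixedField <-: galois M F by apply: galoisS galF; rewrite sub1v.
  apply/fixedFieldP=> [|t _]; first by rewrite rpredX.
  have [j Dj] := radical_conj zeta_prim t (alpha_neq0 i) (Kan i).
  (* This power of [zeta] is a quotient of two conjugates of [alpha_i], and the normal field [E]
     contains both. *)
  have: zeta ^+ j \in E.
    rewrite -(mulfK (alpha_neq0 i) (_ ^+ _)) -Dj.
    apply: rpredM; last by rewrite rpredV sLE.
    have /(normalField1P E)/(_ t) := normal_closure_normal L.
    by move/subvP; apply; apply: memv_img; apply: sLE.
  rewrite memE => /dvdnP[q Dq].
  rewrite rmorphXn /= Dj exprMn -exprM Dq -mulnA [(d * _)%N]mulnC divnK //.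
  by rewrite mulnC exprM (prim_expr_order zeta_prim) expr1n mul1r.
have sME : (M <= E)%VS by rewrite defM; apply/FadjoinP; rewrite sub1v.
have galE := galois_normal_closure sepL.
have nsJG : J <| G.
  apply: (@normalField_normal _ _ _ 1%AS); rewrite ?sub1v //.
  have ->: M = <<1 & [:: zeta]>>%AS by apply: val_inj; rewrite /= adjoin_seq1.
  apply: normalField_adjoin_seq => f x /[!inE] /eqP->.
  have [j ->] := radical_conj zeta_prim f nz_zeta Kzn.
  have Nzeta : zeta \in <<1 & [:: zeta]>>%AS by rewrite seqv_sub_adjoin ?mem_head.
  by rewrite rpredM ?rpredX.
have srsE : {subset zeta :: alpha <= E}.
  by move=> x; rewrite inE => /predU1P[-> // | /alphaL/sLE].
have fixZ : {in J, forall t : gal_of E, t zeta = zeta}.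
  by move=> t Jt; apply: fixed_gal Jt Mzeta.
have fixJ : M = fixedField J :> {vspace Omega}.
  by apply/esym/galois_fixedField; apply: galoisS galE; rewrite sub1v.
have complJ : J \in [complements to G' in G].
  apply/complP; split.
    apply/trivgP/subsetP=> t /setIP[G't Jt]; apply/set1P.
    apply: (gal_eq_gen sEF srsE) => x; rewrite inE gal_id => /predU1P[-> | ax].
      exact: fixZ.
    by apply: fixed_gal G't (alphaL ax); apply: sub_normal_closure.
  have nJG' : G' \subset 'N(J).
    by apply: subset_trans (normal_norm nsJG); apply/galS/sub1v.
  (* Normality of [J] makes [G' * J] a group; its fixed field is contained in those of [G'] and [J],
     hence in [L :&: M = K], so it is all of [G]. *)
  rewrite -norm_joinEl //= -[LHS]gal_fixedField; congr ('Gal(_ / _)).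
  apply/eqP; rewrite eqEsubv sub1v andbT -LM1 subv_cap.
  have /galois_fixedField fixG': galois L E.
    by apply: galoisS galE; rewrite sub1v sub_normal_closure.
  apply/andP; split; first by rewrite -[X in (_ <= X)%VS]fixG' fixedFieldS ?joing_subl.
  by rewrite [X in (_ <= X)%VS]fixJ fixedFieldS ?joing_subr.
have fix_a i : {in J &, forall s t : gal_of E,
    s (t (tnth alpha i) / tnth alpha i) = t (tnth alpha i) / tnth alpha i}.
  move=> s t Js Jt; have [j ->] := radical_conj zeta_prim t (alpha_neq0 i) (Kan i).
  by rewrite mulfK // rmorphXn /= fixZ.
have abJ : abelian J.
  apply/centsP=> s Js t Jt; apply: (gal_eq_gen sEF srsE) => x rs_x.
  have Ex := srsE x rs_x; rewrite !galM //.
  move: rs_x; rewrite inE => /predU1P[-> | /tnthP[i ->]]; first by rewrite !fixZ.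
  have [j Dj] := radical_conj zeta_prim t (alpha_neq0 i) (Kan i).
  have [l Dl] := radical_conj zeta_prim s (alpha_neq0 i) (Kan i).
  by rewrite Dj Dl !rmorphM !rmorphXn /= !fixZ // Dj Dl mulrCA.
split; last by move=> i; apply/(hopf_eigenvectorP sepL nsJG complJ abJ).
split=> //; first by split=> //; exists J.
have e_n : (exponent J %| n)%N.
  apply/exponentP=> t Jt; apply: (gal_eq_gen sEF srsE) => x.
  rewrite gal_id inE => /predU1P[-> | /tnthP[i ->]]; first by rewrite fixZ ?groupX.
  by apply/eqP; rewrite galX_fix ?sLE ?fix_a // AEnd_fix1.
(* With [e] the exponent of [J], each [alpha_i ^+ e] is fixed by [J], so it lies in [L :&: M = K],
   and minimality of [n] gives [n <= e]. *)
apply/eqP; rewrite eqn_leq dvdn_leq //=; apply: min_n => [|i].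
  exact: exponent_gt0.
rewrite -LM1 memv_cap rpredX //=.
suffices: tnth alpha i ^+ exponent J \in fixedField J by rewrite -fixJ.
apply/fixedFieldP=> [|t Jt]; first by rewrite rpredX ?sLE.
by apply/eqP; rewrite -galX_fix ?sLE ?fix_a // expg_exponent // gal_id.
Qed.

End Radical.

Theorem theorem1p1 (n : nat) (K : fieldType) (Omega : splittingFieldType K)
    (zeta : Omega) (M L : {subfield Omega}) (k : nat) (alpha : k.-tuple Omega)
    (n_gt0 : (0 < n)%N)
    (char_n : forall p, p \in [pchar K] -> ~~ (p %| n)%N)
    (zeta_prim : n.-primitive_root zeta)
    (defM : M = <<1; zeta>>%VS :> {vspace Omega})
    (L_dec : strongly_decomposable L)
    (alphaL : {subset alpha <= L})
    (alpha_neq0 : forall i, tnth alpha i != 0)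
    (defL : L = <<1 & alpha>>%VS :> {vspace Omega})
    (alpha_disj : forall i j : 'I_k, i != j ->
       strongly_disjoint <<1; tnth alpha i>>%AS <<1; tnth alpha j>>%AS) :
  [/\ (L :&: M)%VS = 1%VS,
      forall i, tnth alpha i ^+ n \in 1%VS
    & forall m, (0 < m)%N -> (forall i, tnth alpha i ^+ m \in 1%VS) ->
        (n <= m)%N]
  <->
  almost_kummer n L M /\
  (forall i, hopf_eigenvector (acg_group L M) (tnth alpha i)).
Proof.
split=> [[LM1 Kan min_n] | [kumLM eig]].
  exact: (radical_almost_kummer zeta_prim defM).
exact: almost_kummer_radical alphaL alpha_neq0 defL kumLM eig.
Qed.
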